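(* Let $K\subset\mathbb{R}$ be a real number field of degree $d=s+2t\geq 2$, with $s\ge 1$ real embeddings and $2t\ge 0$ non-real embeddings into $\mathbb{C}$, labelled $\sigma_1,\dots,\sigma_d$ as in the context. Let $(x_2,\dots,x_{s+t})$ be an element of $\mathbb{R}^{s-1}\times\mathbb{C}^{t}$ (with $x_2,\dots,x_s$ real and $x_{s+1},\dots,x_{s+t}$ complex) all of whose components are of modulus less than $1$, and let $\varepsilon>0$ be sufficiently small that all real intervals $[x_j-\varepsilon,x_j+\varepsilon]$, $2\le j\le s$, and all complex discs $\{z\in\mathbb{C}: |z-x_{s+j}|\le\varepsilon\}$, $1\le j\le t$, are contained in the open unit disc $\{z\in\mathbb{C}: |z|<1\}$. Then there is a positive constant $c=c(K,\varepsilon)$, depending only on $K$ and $\varepsilon$, such that for every $x_1\in\mathbb{R}$ the interval $[x_1-c,x_1+c]$ contains an algebraic integer $\theta\in K$ such that $|x_j-\sigma_j(\theta)|\le\varepsilon$ for every $j\in\{2,\dots,s+t\}$.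
   Context: A real number field $K$ is a subfield of $\mathbb{R}$ of finite degree over $\mathbb{Q}$. It has $s\ge1$ real embeddings and $2t\ge 0$ non-real embeddings into $\mathbb{C}$, with $d=s+2t=[K:\mathbb{Q}]$. The distinct embeddings $\sigma_1,\dots,\sigma_d$ of $K$ into $\mathbb{C}$ are labelled so that $\sigma_1$ is the identity (inclusion) of $K$, $\sigma_j$ is real if and only if $j\le s$, and for $j\in\{1,\dots,t\}$ the embedding $\sigma_{s+t+j}$ is the composition of complex conjugation with $\sigma_{s+j}$. *)

(* Defs.v *)
From HB Require Import structures.
From mathcomp Require Import all_boot all_order all_algebra all_field.
From mathcomp Require Import reals complex.

Set Implicit Arguments.
Unset Strict Implicit.
Unset Printing Implicit Defensive.

Import Order.TTheory GRing.Theory Num.Theory.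

Local Open Scope ring_scope.
Local Open Scope complex_scope.

(* A real number field is given by a finite extension [K] of the rationals
   together with its inclusion [iota] into the reals.  Embeddings are numbered
   from 0: [sigma i] is the embedding usually written sigma_(i+1). *)
Record labelled_embeddings (R : realType) (K : fieldExtType rat)
    (iota : {rmorphism K -> R}) (s t : nat)
    (sigma : 'I_(\dim {:K}) -> {rmorphism K -> R[i]}) : Prop :=
  LabelledEmbeddings {
    embeddings_distinct : forall i j, sigma i =1 sigma j -> i = j;
    embeddings_all : forall f : {rmorphism K -> R[i]}, exists i, sigma i =1 f;
    embeddings_first : forall i : 'I_(\dim {:K}), i = 0 :> nat ->
      forall a, sigma i a = (iota a)%:C;
    embeddings_real : forall i : 'I_(\dim {:K}),
      (forall a, sigma i a \is Num.real) <-> (i < s)%N;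
    embeddings_conj : forall i k : 'I_(\dim {:K}),
      (s <= i < s + t)%N -> k = (i + t)%N :> nat ->
      forall a, sigma k a = (sigma i a)^*
  }.

(* Main.v *)
Require Import Defs.
From HB Require Import structures.
From mathcomp Require Import all_boot all_order all_algebra all_field.
From mathcomp Require Import reals complex.
From mathcomp Require Import boolp ring lra zify.

Set Implicit Arguments.
Unset Strict Implicit.
Unset Printing Implicit Defensive.

Import Order.TTheory GRing.Theory Num.Theory.

Local Open Scope ring_scope.
Local Open Scope complex_scope.

(* By the pigeonhole principle, Z[gamma] (gamma an integral primitive element)
   contains some a <> 0 all of whose conjugates except the first are as small as
   we like: being small in these d - 1 real coordinates is a system of d - 1 real
   linear inequalities in d integer unknowns.  The vectors (sigma_j(a gamma^i))_j,
   i < d, span R^s x C^t over R because the Vandermonde matrix of the conjugates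
   of gamma is invertible.  Write the target (x_1, ..., x_(s+t)) in this basis and
   round the coordinates down: the error in the j-th place is at most
   |sigma_j(a)| \sum_i |sigma_j(gamma)|^i, which is at most eps for j > 1 and
   does not depend on the target for j = 1. *)

(** * Small values of real linear forms at integer points *)

(** Integer vectors with entries in [0, N) are sorted by the box of side [delta] that contains their
    values under the forms; two vectors in one box have the required difference. *)
Lemma small_linear_forms (R : archiRealFieldType) (I J : finType)
    (A : J -> I -> R) (delta : R) :
  (#|J| < #|I|)%N -> 0 < delta ->
  exists2 v : I -> int, exists i, v i != 0
    & forall j, `|\sum_i A j i * (v i)%:~R| <= delta.
Proof.
move=> ltJI delta_gt0.
pose B := \sum_j \sum_i `|A j i|.
have B_ge0 : 0 <= B by apply: sumr_ge0 => j _; apply: sumr_ge0.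
have leB j : \sum_i `|A j i| <= B.
  by rewrite /B (bigD1 j) //= lerDl sumr_ge0 // => k _; apply: sumr_ge0.
pose k := (Num.truncn (2 * B / delta)).+1.
have ltk : 2 * B < k%:R * delta.
  by rewrite -ltr_pdivrMr // truncnS_gt.
(* All values of a form lie in a range cut into [k * N] intervals. Since [N] exceeds [k ^ #|J|],
   there are fewer boxes, [(k * N) ^ #|J|], than vectors, [N ^ #|I|]. *)
pose N := (k ^ #|J|).+1.
pose L (a : {ffun I -> 'I_N}) j : R := \sum_i A j i * (a i)%:R.
have leL a j : `|L a j| <= B * N%:R.
  apply: le_trans (ler_norm_sum _ _ _) _.
  apply: le_trans (ler_wpM2r (ler0n R N) (leB j)).
  rewrite mulr_suml; apply: ler_sum => i _.
  by rewrite normrM normr_nat ler_wpM2l // ler_nat ltnW.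
pose u a j := (L a j + B * N%:R) / delta.
have u_ge0 a j : 0 <= u a j.
  have := leL a j; rewrite ler_norml => /andP[? _].
  by rewrite divr_ge0 ?(ltW delta_gt0) //; lra.
have lt_u a j : (Num.truncn (u a j) < k * N)%N.
  rewrite -(ltr_nat R); have /andP[le_u _] := truncn_itv (u_ge0 a j).
  apply: le_lt_trans le_u _; rewrite ltr_pdivrMr // natrM mulrAC.
  have : 2 * B * N%:R < k%:R * delta * N%:R by rewrite ltr_pM2r ?ltr0n.
  by have := leL a j; rewrite ler_norml => /andP[_ ?]; lra.
pose g (a : {ffun I -> 'I_N}) : {ffun J -> 'I_(k * N)} :=
  [ffun j => Ordinal (lt_u a j)].
have /injectivePn[a [b neq_ab eq_g]] : ~~ injectiveb g.
  apply/negP=> /injectiveP/leq_card; rewrite !card_ffun !card_ord expnMn leqNgt.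
  case/negP; apply: (@leq_trans (N ^ #|J|.+1)); last exact: leq_pexp2l.
  by rewrite expnS ltn_pmul2r ?expn_gt0.
exists (fun i => (a i)%:Z - (b i)%:Z).
  have [i neq_i] : exists i, a i != b i.
    apply/existsP; apply: contraNT neq_ab => /existsPn eq_ab.
    by apply/eqP/ffunP => i; apply/eqP; have := eq_ab i; rewrite negbK.
  by exists i; rewrite subr_eq0 eqz_nat.
move=> j.
have -> : \sum_i A j i * ((a i)%:Z - (b i)%:Z)%:~R = (u a j - u b j) * delta.
  rewrite -mulrBl divfK ?gt_eqF // opprD addrACA subrr addr0 -sumrB.
  by apply: eq_bigr => i _; rewrite rmorphB /= mulrBr.
rewrite normrM (gtr0_norm delta_gt0) ger_pMl //.
have /(congr1 val)/= eq_j : g a j = g b j by rewrite eq_g.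
rewrite !ffunE /= in eq_j.
have /andP[a1 a2] := truncn_itv (u_ge0 a j); have /andP[b1 b2] := truncn_itv (u_ge0 b j).
rewrite eq_j in a1 a2; rewrite -addn1 natrD in a2 b2.
by rewrite ler_norml; apply/andP; split; lra.
Qed.

(** * Integral primitive elements *)

(** Let a be the leading coefficient and n the degree. Multiplying p(z) = 0 by a^(n-1) gives a monic
    equation for a z with coefficients still in the image of [f]. *)
Lemma integral_lead_coef_mul (A : idomainType) (K : fieldType)
    (f : {rmorphism A -> K}) (p : {poly A}) (z : K) :
  injective f -> p != 0 -> root (map_poly f p) z ->
  integralOver f (f (lead_coef p) * z).
Proof.
move=> f_inj p_neq0 /rootP pz0; set a := lead_coef p; pose n := (size p).-1.
have sz_p : size p = n.+1 by rewrite prednK // size_poly_gt0.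
have n_gt0 : (0 < n)%N.
  rewrite lt0n; apply: contraNneq p_neq0 => n0.
  have/eqP/size_poly1P[c c_neq0 pE] : size p = 1%N by rewrite sz_p n0.
  move: pz0; rewrite pE map_polyC hornerC => /eqP.
  by rewrite -(rmorph0 f) (inj_eq f_inj) (negPf c_neq0).
pose q : {poly K} := 'X^n + \poly_(i < n) f (p`_i * a ^+ (n.-1 - i)).
have q_monic : q \is monic.
  by rewrite monicE lead_coefDl ?lead_coefXn // size_polyXn ltnS size_poly.
apply: (integral_root_monic q_monic).
  rewrite rootE hornerD hornerXn horner_poly exprMn -rmorphXn /=.
  have -> : f (a ^+ n) * z ^+ n = f (a ^+ n.-1) * (f p`_n * z ^+ n).
    by rewrite mulrA -rmorphM /= -[p`_n]/(lead_coef p) -exprSr prednK.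
  have -> : \sum_(i < n) f (p`_i * a ^+ (n.-1 - i)) * (f a * z) ^+ i
          = f (a ^+ n.-1) * \sum_(i < n) f p`_i * z ^+ i.
    rewrite mulr_sumr; apply: eq_bigr => i _.
    have le_i : (i <= n.-1)%N by rewrite -ltnS prednK.
    rewrite -[in RHS](subnK le_i) exprD exprMn -!rmorphXn !rmorphM /=.
    by ring.
  rewrite -mulrDr mulf_eq0; apply/orP; right.
  move: pz0; rewrite horner_coef size_map_inj_poly ?rmorph0 // sz_p big_ord_recr /=.
  rewrite coef_map addrC => pz0; rewrite -[X in _ == X]pz0; apply/eqP; congr (_ + _).
  by apply: eq_bigr => i _; rewrite coef_map.
apply/integral_poly => i; rewrite coefD coefXn coef_poly.
apply: integral_add; first exact: integral_nat.
by case: ifP => _; [exact: integral_id | exact: integral0].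
Qed.

Lemma intr_eq0_rat_algebra (K : fieldExtType rat) (m : int) :
  (m%:~R == 0 :> K) = (m == 0).
Proof. by rewrite -(rmorph_int (in_alg K)) fmorph_eq0 intr_eq0. Qed.

Lemma integral_int_multiple (K : fieldExtType rat) (z : K) :
  exists2 a : int, a != 0 & integralOver (intr : int -> K) (a%:~R * z).
Proof.
have intr_inj : injective (intr : int -> K).
  move=> m n /eqP; rewrite -subr_eq0 -mulrzBr intr_eq0_rat_algebra subr_eq0.
  by move/eqP.
have /polyOver1P[q Dq] := minPolyOver 1 z.
have [p [a a_neq0 Dp]] := rat_poly_scale q.
have q_neq0 : q != 0.
  by rewrite -(map_poly_eq0 (in_alg K)) -Dq monic_neq0 ?monic_minPoly.
have p_neq0 : p != 0 by apply: contraNneq q_neq0 => p0; rewrite Dp p0 rmorph0 scaler0.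
exists (lead_coef p); first by rewrite lead_coef_eq0.
apply: integral_lead_coef_mul => //.
have := root_minPoly 1 z; rewrite Dq Dp linearZ /= rootZ //.
  by rewrite -map_poly_comp (eq_map_poly (rmorph_int _)).
by rewrite scaler_eq0 oner_eq0 orbF invr_eq0 intr_eq0.
Qed.

(** The second conclusion is the form in which K = Q(gamma) is used: distinct embeddings differ at
    gamma. A separable generator is made integral by a nonzero integer factor, which embeddings into
    any field keep nonzero. *)
Lemma integral_primitive_element (K : fieldExtType rat) :
  exists2 gamma : K, integralOver (intr : int -> K) gamma &
    forall (L : fieldType) (f g : {rmorphism K -> L}),
      f gamma = g gamma -> f =1 g.
Proof.
have pchar0 : [pchar K] =i pred0 := ftrans (pchar_lalg K) (pchar_num _).
have sepK : separable 1 {:K} by apply/separableP => y _; apply: pcharf0_separable.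
have genK := eq_adjoin_separable_generator sepK (sub1v _).
set z := separable_generator _ _ in genK.
have [a a_neq0 int_az] := integral_int_multiple z.
exists (a%:~R * z) => // L f g; rewrite !rmorphM !rmorph_int.
have a_neq0L (h : {rmorphism K -> L}) : (a%:~R : L) != 0.
  by rewrite -(rmorph_int h) fmorph_eq0 intr_eq0_rat_algebra.
move=> /(mulfI (a_neq0L f)) eq_z x.
have /Fadjoin_polyP[_ /polyOver1P[q ->] ->] : x \in <<1; z>>%VS by rewrite -genK memvf.
rewrite -!horner_map /= eq_z -!map_poly_comp; congr _.[_].
apply: eq_map_poly => c.
by rewrite /= !rmorphZ_num !rmorph1.
Qed.

Lemma integral_int_combination (A : comNzRingType) (F : fieldType)
    (f : {rmorphism A -> F}) (n : nat) (v : 'I_n -> A) (z : F) :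
  integralOver f z -> integralOver f (\sum_i f (v i) * z ^+ i).
Proof.
move=> int_z; apply: big_ind => [|x y|i _]; first exact: integral0.
  exact: integral_add.
apply: integral_mul; first exact: integral_id.
by elim: (val i) => [|k IHk]; [exact: integral1 | rewrite exprS; exact: integral_mul].
Qed.

(** * Vandermonde systems and real interpolation *)

Lemma Vandermonde_unit (F : fieldType) (n : nat) (z : 'I_n -> F) :
  injective z -> Vandermonde n (\row_j z j) \in unitmx.
Proof.
move=> z_inj; rewrite unitmxE unitfE det_Vandermonde.
apply/prodf_neq0 => i _; apply/prodf_neq0 => j lt_ij.
rewrite !mxE subr_eq0; apply: contraTneq lt_ij => /z_inj->.
by rewrite ltnn.
Qed.

Lemma eval_powers_inj (F : fieldType) (n : nat) (z v : 'I_n -> F) :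
  injective z -> (forall j, \sum_i v i * z j ^+ i = 0) -> forall i, v i = 0.
Proof.
move=> /Vandermonde_unit V_unit v0 i.
have : (\row_k v k) *m Vandermonde n (\row_j z j) = 0.
  apply/rowP => j; rewrite !mxE -[RHS](v0 j).
  by apply: eq_bigr => k _; rewrite !mxE.
move/(congr1 (mulmx^~ (invmx (Vandermonde n (\row_j z j))))).
by rewrite mul0mx mulmxK // => /rowP/(_ i); rewrite !mxE.
Qed.

(** Conjugation permutes the equations, so the conjugate of the complex solution [w] is again a
    solution, and so is their mean, the real part of [w]. *)
Lemma real_interpolation (R : rcfType) (n : nat) (z y : 'I_n -> R[i]) :
    injective z ->
    (forall j, exists2 k, z k = (z j)^* & y k = (y j)^*) ->
  exists r : 'I_n -> R, forall j, \sum_i (r i)%:C * z j ^+ i = y j.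
Proof.
move=> /Vandermonde_unit V_unit conj_zy.
pose w := (\row_j y j) *m invmx (Vandermonde n (\row_j z j)).
have wE j : \sum_i w 0 i * z j ^+ i = y j.
  have : (w *m Vandermonde n (\row_j z j)) 0 j = y j by rewrite mulmxKV // mxE.
  by rewrite mxE => <-; apply: eq_bigr => i _; rewrite !mxE.
exists (fun i => complex.Re (w 0 i)) => j.
have [k zk yk] := conj_zy j.
have wcE : \sum_i (w 0 i)^* * z j ^+ i = y j.
  rewrite -[y j]conjcK -yk -wE zk rmorph_sum; apply: eq_bigr => i _.
  by rewrite rmorphM rmorphXn /= conjcK.
transitivity ((y j + y j) / 2%:R); last by field.
rewrite -{1}wE -{1}wcE -big_split /= mulr_suml; apply: eq_bigr => i _.
by rewrite ReJ_add; ring.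
Qed.

Lemma norm_real_complex (R : rcfType) (x : R) : `|x%:C| = `|x|%:C.
Proof. by rewrite normc_def /= expr0n addr0 sqrtr_sqr. Qed.

Lemma norm_le_Re_Im (R : rcfType) (z : R[i]) :
  `|z| <= (`|complex.Re z| + `|complex.Im z|)%:C.
Proof.
rewrite {1}[z]complexE (le_trans (ler_normD _ _)) // normrM !norm_real_complex.
by rewrite normc_def /= expr0n expr1n add0r sqrtr1 mul1r -rmorphD.
Qed.

Lemma rounding_error (R : realType) (K : fieldType) (f : {rmorphism K -> R[i]})
    (n : nat) (r : 'I_n -> R) (z a : K) :
  `|f a * \sum_i (r i)%:C * f z ^+ i
    - f (a * \sum_i (Num.floor (r i))%:~R * z ^+ i)|
  <= `|f a| * \sum_(i < n) `|f z| ^+ i.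
Proof.
rewrite rmorphM -mulrBr normrM ler_wpM2l // rmorph_sum -sumrB.
apply: le_trans (ler_norm_sum _ _ _) _; apply: ler_sum => i _.
rewrite rmorphM rmorphXn rmorph_int -mulrBl normrM normrX /=.
rewrite -[leRHS]mul1r ler_wpM2r ?exprn_ge0 //.
rewrite -(rmorph_int (real_complex R)) -rmorphB /= norm_real_complex.
rewrite (_ : 1 = 1%:C) // lecR.
have /andP[le_r] := floor_itv (r i); rewrite intrD => lt_r.
by rewrite ger0_norm; lra.
Qed.

(** * A nonzero algebraic integer that is small at all places but the first *)

Lemma small_integral_element (R : realType) (K : fieldExtType rat)
    (iota : {rmorphism K -> R}) (s t : nat)
    (sigma : 'I_(\dim {:K}) -> {rmorphism K -> R[i]}) (gamma : K) (delta : R) :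
    (1 <= s)%N -> \dim {:K} = (s + 2 * t)%N ->
    labelled_embeddings iota s t sigma ->
    integralOver (intr : int -> K) gamma ->
    injective (fun j => sigma j gamma) -> 0 < delta ->
  exists a : K, [/\ integralOver (intr : int -> K) a, a != 0
    & forall j : 'I_(\dim {:K}), j != 0 :> nat -> `|sigma j a| <= delta%:C].
Proof.
move=> s_gt0 dimK [_ _ _ sigma_real sigma_conj] int_g g_inj delta_gt0.
(* One real coordinate per embedding: the real part for the first member of each
   conjugate pair, the imaginary part for the second. *)
pose coord (j : nat) : R[i] -> R :=
  if (j < s + t)%N then @complex.Re R else @complex.Im R.
have coord_comb (j : nat) n (v : 'I_n -> int) (z : 'I_n -> R[i]) :
  coord j (\sum_i (v i)%:~R * z i) = \sum_i coord j (z i) * (v i)%:~R.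
  rewrite /coord; case: ifP => _.
    rewrite (raddf_sum (@complex.Re R : Rcomplex R -> R)) /=.
    apply: eq_bigr => i _; rewrite -(rmorph_int (real_complex R)).
    by case: (z i) => x y /=; ring.
  rewrite (raddf_sum (@complex.Im R : Rcomplex R -> R)) /=.
  apply: eq_bigr => i _; rewrite -(rmorph_int (real_complex R)).
  by case: (z i) => x y /=; ring.
have d_gt0 : (0 < \dim {:K})%N by lia.
pose J := {j : 'I_(\dim {:K}) | j != Ordinal d_gt0}.
have ltJ : (#|{: J}| < #|'I_(\dim {:K})|)%N.
  by rewrite card_sig cardC1 card_ord prednK.
(* The bound is [delta / 2] because a complex modulus is at most the sum of the moduli of its real
   and imaginary parts. *)
have [v [i0 v_neq0] small_v] := small_linear_forms
  (fun (j : J) (i : 'I_(\dim {:K})) => coord (val j) (sigma (val j) gamma ^+ i))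
  ltJ (divr_gt0 delta_gt0 (ltr0n R 2)).
pose a := \sum_i (v i)%:~R * gamma ^+ i.
have sigma_a j : sigma j a = \sum_i (v i)%:~R * sigma j gamma ^+ i.
  rewrite rmorph_sum; apply: eq_bigr => i _.
  by rewrite rmorphM rmorphXn rmorph_int.
have small_coord (j : 'I_(\dim {:K})) :
    j != 0 :> nat -> `|coord j (sigma j a)| <= delta / 2.
  move=> j_neq0; have Jj : j != Ordinal d_gt0 by [].
  by have := small_v (exist _ j Jj); rewrite sigma_a coord_comb.
exists a; split; first exact: (integral_int_combination _ int_g).
  (* If [a] were 0, the polynomial with coefficients [v], of degree less than d, would vanish at the
     d distinct conjugates of [gamma]. *)
  apply: contra v_neq0 => /eqP a0.
  have := @eval_powers_inj R[i] _ _ (fun i => (v i)%:~R) g_inj.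
  move=> /(_ _ i0) /= v0; rewrite -(intr_eq0 R[i]); apply/eqP/v0 => j.
  by rewrite -sigma_a a0 rmorph0.
move=> j j_neq0; have lt_jd := ltn_ord j.
apply: le_trans (norm_le_Re_Im _) _; rewrite lecR.
have := small_coord j j_neq0; rewrite /coord.
case: (ltnP j s) => [lt_js|le_sj].
  have /sigma_real/(_ a)/complex_realP[x ->] := lt_js.
  rewrite ltn_addr //= normr0; lra.
(* For a non-real embedding the missing coordinate comes from its conjugate partner, at index
   [j + t] or [j - t]: the real parts agree and the imaginary parts differ in sign. *)
case: (ltnP j (s + t)) => [lt_jst|le_stj].
  have lt_k : (j + t < \dim {:K})%N by lia.
  have := small_coord (Ordinal lt_k); rewrite /coord /=.
  rewrite (@sigma_conj j (Ordinal lt_k)) ?le_sj //=.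
  case: ltnP => [|_ /(_ _)]; first by lia.
  case: (sigma j a) => x y /=; rewrite normrN.
  by move=> /(_ ltac:(lia)); lra.
have lt_k : (j - t < \dim {:K})%N by lia.
have := small_coord (Ordinal lt_k); rewrite /coord /=.
rewrite (@sigma_conj (Ordinal lt_k) j) /=; [|lia|lia].
case: ltnP => [_|]; last by lia.
case: (sigma _ a) => x y /=; rewrite normrN.
by move=> /(_ ltac:(lia)); lra.
Qed.

(** * Approximation with a uniform constant *)

(* MathComp world.  x_2, ..., x_s are xr 0, ..., xr (s-2), and
   x_(s+1), ..., x_(s+t) are xc 0, ..., xc (t-1). *)
Theorem theorem1 (R : realType) (K : fieldExtType rat)
    (iota : {rmorphism K -> R}) (hd : (2 <= \dim {:K})%N)
    (eps : R) (heps : 0 < eps) :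
  exists2 c : R, 0 < c &
    forall (s t : nat) (hs : (1 <= s)%N) (hst : \dim {:K} = (s + 2 * t)%N)
      (sigma : 'I_(\dim {:K}) -> {rmorphism K -> R[i]})
      (hsigma : labelled_embeddings iota s t sigma)
      (xr : 'I_s.-1 -> R) (xc : 'I_t -> R[i])
      (hxr : forall j, `|xr j| < 1) (hxc : forall j, `|xc j| < 1)
      (hepsr : forall j (y : R), y \in `[xr j - eps, xr j + eps] -> `|y| < 1)
      (hepsc : forall j (z : R[i]), `|z - xc j| <= eps%:C -> `|z| < 1)
      (x1 : R),
    exists theta : K,
      [/\ integralOver (intr : int -> K) theta,
          iota theta \in `[x1 - c, x1 + c],
          forall (j : 'I_s.-1) (i : 'I_(\dim {:K})), i = j.+1 :> nat ->
            `|(xr j)%:C - sigma i theta| <= eps%:C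
        & forall (j : 'I_t) (i : 'I_(\dim {:K})), i = (s + j)%N :> nat ->
            `|xc j - sigma i theta| <= eps%:C].
Proof.
have [gamma int_g gen_g] := integral_primitive_element K.
pose labelling s t sigma := [/\ (1 <= s)%N, \dim {:K} = (s + 2 * t)%N
  & labelled_embeddings iota s t sigma].
have g_inj s t sigma : labelling s t sigma -> injective (fun j => sigma j gamma).
  by case=> _ _ [sigma_inj _ _ _ _] i j /gen_g/sigma_inj.
have d_gt0 : (0 < \dim {:K})%N by lia.
pose j0 := Ordinal d_gt0.
(* [c] is chosen before the labelling.  Two labellings differ by a permutation
   fixing 0, so an [a] that is small for one of them is small for all of them. *)
have [[s0 [t0 [sigma0 lab0]]]|no_lab] :=
  pselect (exists s t sigma, labelling s t sigma); last first.
  exists 1 => // s t hs hst sigma hsigma; case: no_lab.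
  by exists s, t, sigma.
pose M := \sum_j \sum_(i < \dim {:K}) complex.Re `|sigma0 j gamma| ^+ i.
have ReK (z : R[i]) : (complex.Re `|z|)%:C = `|z| by rewrite normc_def.
have Re_ge0 (z : R[i]) : 0 <= complex.Re `|z| by rewrite normc_def sqrtr_ge0.
have M_ge0 : 0 <= M.
  by apply: sumr_ge0 => j _; apply: sumr_ge0 => i _; apply: exprn_ge0.
have leM j : \sum_(i < \dim {:K}) `|sigma0 j gamma| ^+ i <= M%:C.
  rewrite -(ReK (sigma0 j gamma)).
  under eq_bigr do rewrite -rmorphXn.
  rewrite -rmorph_sum lecR [M](bigD1 j) //= lerDl sumr_ge0 // => k _.
  by apply: sumr_ge0 => i _; apply/exprn_ge0/(Re_ge0 (sigma0 k gamma)).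
(* [M] bounds the power sums at all places, so [delta * M <= eps]; the 1 keeps the denominator
   positive. *)
have delta_gt0 : 0 < eps / (M + 1) by rewrite divr_gt0 // ltr_pwDr.
have [a [int_a a_neq0 small_a]] : exists a : K,
    [/\ integralOver (intr : int -> K) a, a != 0
      & forall j : 'I_(\dim {:K}), j != 0 :> nat -> `|sigma0 j a| <= (eps / (M + 1))%:C].
  by case: (lab0) => *; apply: small_integral_element (g_inj _ _ _ lab0) delta_gt0; eauto.
(* This is the rounding error at the first place. *)
pose c0 := `|iota a| * \sum_(i < \dim {:K}) `|iota gamma| ^+ i.
have c0_ge0 : 0 <= c0 by rewrite mulr_ge0 // sumr_ge0 // => i _; apply: exprn_ge0.
exists (c0 + 1); first by rewrite ltr_pwDr.
move=> s t hs hst sigma hsigma xr xc _ _ _ _ x1.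
have lab : labelling s t sigma by [].
case: (hsigma) => sigma_inj sigma_all sigma_first sigma_real sigma_conj.
case: (lab0) => _ _ [sigma0_inj sigma0_all sigma0_first _ _].
have small (j : 'I_(\dim {:K})) : j != 0 :> nat ->
    `|sigma j a| * \sum_(i < \dim {:K}) `|sigma j gamma| ^+ i <= eps%:C.
  move=> j_neq0; have [k sigma_k] := sigma0_all (sigma j).
  rewrite -!sigma_k.
  (* Both labellings put the inclusion at index 0, so [k = 0] would force [j = 0]. *)
  have k_neq0 : k != 0 :> nat.
    apply: contraNneq j_neq0 => k0; apply/eqP.
    have -> // : j = j0.
    by apply: sigma_inj => x; rewrite -sigma_k sigma0_first // sigma_first.
  apply: le_trans (ler_pM _ _ (small_a _ k_neq0) (leM k)) _ => //.
    by apply: sumr_ge0 => i _; apply: exprn_ge0.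
  rewrite -rmorphM lecR mulrAC ler_pdivrMr ?ltr_pwDr //; nra.
(* The target is extended to all d places, with conjugate values at conjugate embeddings. Each
   [insub] is tried only after the earlier ranges fail, so the subtractions are exact, and the final
   0 is never reached because j < s + 2t. *)
pose X (j : 'I_(\dim {:K})) : R[i] :=
  if j == 0 :> nat then x1%:C else
  if insub (j.-1) is Some k then (xr k)%:C else
  if insub (j - s)%N is Some k then xc k else
  if insub (j - s - t)%N is Some k then (xc k)^* else 0.
have X_real (j : 'I_(\dim {:K})) : (j < s)%N -> (X j)^* = X j.
  move=> lt_js; rewrite /X; case: eqP => [_|/eqP j_neq0]; first exact: conjc_real.
  case: insubP => [k _ _|]; first exact: conjc_real.
  by rewrite -ltnNge; lia.
have X_conj (j k : 'I_(\dim {:K})) : (s <= j < s + t)%N -> k = (j + t)%N :> nat ->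
  X k = (X j)^*.
  move=> j_st kE; rewrite /X.
  have -> : (k == 0 :> nat) = false by lia.
  have -> : (j == 0 :> nat) = false by lia.
  do 2 (rewrite insubF; last by lia).
  have -> : (k - s - t)%N = (j - s)%N by lia.
  rewrite [insub j.-1]insubF; last by lia.
  by case: insubP => //; lia.
(* Interpolating [X j / sigma j a] gives the coordinates of the target in the basis a gamma^i. *)
have [r rE] : exists r : 'I_(\dim {:K}) -> R, forall j,
    \sum_i (r i)%:C * sigma j gamma ^+ i = X j / sigma j a.
  apply: real_interpolation (g_inj _ _ _ lab) _ => j.
  have conj_pair (k : 'I_(\dim {:K})) : (forall x, sigma k x = (sigma j x)^*) ->
      X k = (X j)^* -> exists2 k, sigma k gamma = (sigma j gamma)^*
        & X k / sigma k a = (X j / sigma j a)^*.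
    by move=> sE XE; exists k; rewrite // sE XE rmorphM /= conjc_inv.
  have lt_jd := ltn_ord j.
  case: (ltnP j s) => [lt_js|le_sj].
    apply: (conj_pair j) => [x|]; last by rewrite X_real.
    have /sigma_real/(_ x)/complex_realP[y ->] := lt_js.
    by rewrite conjc_real.
  case: (ltnP j (s + t)) => [lt_jst|le_stj].
    have lt_k : (j + t < \dim {:K})%N by lia.
    by apply: (conj_pair (Ordinal lt_k)) => [x|]; [apply: sigma_conj|apply: X_conj];
      rewrite ?le_sj.
  have lt_k : (j - t < \dim {:K})%N by lia.
  apply: (conj_pair (Ordinal lt_k)) => [x|]; apply: (can_inj (@conjcK R));
    rewrite conjcK; symmetry; [apply: sigma_conj|apply: X_conj]; rewrite /=; lia.
pose theta := a * \sum_i (Num.floor (r i))%:~R * gamma ^+ i.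
have near_theta j : `|X j - sigma j theta|
    <= `|sigma j a| * \sum_(i < \dim {:K}) `|sigma j gamma| ^+ i.
  have := rounding_error (sigma j) r gamma a.
  by rewrite rE mulrCA divff ?fmorph_eq0 // mulr1.
exists theta; split.
- exact: integral_mul int_a (integral_int_combination _ int_g).
(* At index 0 every term is real, so the complex estimate descends to one over [R] with bound
   [c0]. *)
- have := near_theta j0; rewrite /X /= !(sigma_first j0) //.
  rewrite !norm_real_complex -rmorphB norm_real_complex.
  under eq_bigr do rewrite -rmorphXn.
  rewrite -rmorph_sum -rmorphM lecR -/c0 ler_norml in_itv /= => /andP[? ?].
  by apply/andP; split; lra.
- move=> j i iE; have i_neq0 : i != 0 :> nat by rewrite iE.
  apply: le_trans (small _ i_neq0); have := near_theta i.
  by rewrite {1}/X (negPf i_neq0) iE /= valK.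
- move=> j i iE; have i_neq0 : i != 0 :> nat by lia.
  apply: le_trans (small _ i_neq0); have := near_theta i.
  rewrite {1}/X (negPf i_neq0) insubF; last by lia.
  by rewrite iE addKn valK.
Qed.
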